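(* Let $k$ be an algebraically closed field of characteristic $2$ and let $G$ be a finite group of even order. Let $M$ be a self-dual irreducible $kG$-module. Then the symmetric vertices of $M$ are uniquely determined up to $G$-conjugacy (that is, any two symmetric vertices of $M$ are conjugate in $G$).
   Context: All modules are finite-dimensional left modules. A $G$-form on a $kG$-module $M$ is a non-degenerate $G$-invariant symmetric bilinear form $B:M\times M\to k$; then $(M,B)$ is called a symmetric $kG$-module and $M$ is said to have symmetric type. Every self-dual irreducible $kG$-module has symmetric type. A $kG$-isometry is a $kG$-homomorphism preserving the forms; $(L,B_L)$ is a component of $(M,B)$ if there is a $kG$-isometry $(L,B_L)\to(M,B)$. For $H\le G$ and a symmetric $kH$-module $(L,B_L)$, $\mathrm{Ind}_H^G(L,B_L)$ is $\mathrm{Ind}_H^G L$ with the induced $G$-form $B_L^G(g_1\otimes \ell_1,g_2\otimes \ell_2)=B_L(g_2^{-1}g_1\ell_1,\ell_2)$ if $g_1H=g_2H$ and $0$ otherwise. A $G$-form $B$ on $M$ is $H$-projective if $(M,B)$ is a component of $\mathrm{Ind}_H^G(L,B_L)$ for some symmetric $kH$-module $(L,B_L)$. $M$ is symmetrically $H$-projective if it affords an $H$-projective $G$-form. If $M$ is indecomposable of symmetric type, a symmetric vertex of $M$ is a subgroup $T$ of $G$ that is minimal (under inclusion) subject to $M$ being symmetrically $T$-projective. *)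

(* Defs.v *)
From HB Require Import structures.
From mathcomp Require Import all_boot all_order all_algebra all_fingroup.
From mathcomp Require Import mxrepresentation.

Set Implicit Arguments.
Unset Strict Implicit.
Unset Printing Implicit Defensive.

Import GRing.Theory.
Import GroupScope.
Local Open Scope ring_scope.

(* A finite-dimensional left kG-module is rG : mx_representation k G n, with
   underlying space 'rV[k]_n and left action g . v = v *m rG g^-1 (lact below).
   Since MathComp lets matrices act on row vectors from the right, submodules,
   kG-homomorphisms and irreducibility of this left module are exactly those of
   rG in mxrepresentation. A bilinear form is given by its Gram matrix B:
   bform B u v = u *m B *m v^T. *)

Section Modules.

Variables (k : fieldType) (gT : finGroupType) (G : {group gT}).

Definition lact n (rG : mx_representation k G n) (g : gT) (v : 'rV[k]_n) :
  'rV[k]_n := v *m rG g^-1%g.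

Definition bform n (B : 'M[k]_n) (u v : 'rV[k]_n) : k := (u *m B *m v^T) 0 0.

Section Dual.

Variables (n : nat) (rG : mx_representation k G n).

Definition dual_mx (x : gT) : 'M[k]_n := (rG x^-1%g)^T.

Lemma dual_mx_repr : mx_repr G dual_mx.
Proof.
split=> [|x y Gx Gy]; first by rewrite /dual_mx invg1 repr_mx1 trmx1.
by rewrite /dual_mx invMg repr_mxM ?groupV // trmx_mul.
Qed.

Definition dual_repr : mx_representation k G n := MxRepresentation dual_mx_repr.

End Dual.

Definition self_dual n (rG : mx_representation k G n) : Prop :=
  mx_rsim rG (dual_repr rG).

Definition is_Gform n (rG : mx_representation k G n) (B : 'M[k]_n) : Prop :=
  [/\ forall u v, bform B u v = bform B v u,
      forall u, (forall v, bform B u v = 0) -> u = 0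
    & {in G, forall g u v, bform B (lact rG g u) (lact rG g v) = bform B u v}].

Definition kG_isometry m n (rM : mx_representation k G m) (BM : 'M[k]_m)
    (rN : mx_representation k G n) (BN : 'M[k]_n) (A : 'M[k]_(m, n)) : Prop :=
  {in G, forall g v, lact rM g v *m A = lact rN g (v *m A)}
  /\ (forall u v, bform BN (u *m A) (v *m A) = bform BM u v).

Definition component m n (rM : mx_representation k G m) (BM : 'M[k]_m)
    (rN : mx_representation k G n) (BN : 'M[k]_n) : Prop :=
  exists A : 'M[k]_(m, n), kG_isometry rM BM rN BN A.

End Modules.

Section Induction.

Variables (k : fieldType) (gT : finGroupType) (G H : {group gT}).
Hypothesis sHG : H \subset G.
Variables (l : nat) (rH : mx_representation k H l).

(* With t_i a representative of the i-th left coset of H in G, the i-th block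
   of coordinates of Ind_H^G L = kG (x)_kH L is the subspace t_i (x) L. *)
Definition coset_rep (i : 'I_#|lcosets H G|) : gT := repr (enum_val i).

Definition ext0_mx (x : gT) : 'M[k]_l := if x \in H then rH x else 0.

Definition ind_mx (x : gT) : 'M[k]_(\sum_(i < #|lcosets H G|) l) :=
  \mxblock_(i < #|lcosets H G|, j < #|lcosets H G|)
     ext0_mx ((coset_rep i)^-1 * x * coset_rep j)%g.

Lemma lcoset_rep i : (coset_rep i *: H)%g = enum_val i.
Proof.
have /lcosetsP[x _ def_i] := enum_valP i.
rewrite /coset_rep def_i.
by apply/lcoset_eqP; exact: (mem_repr x (lcoset_refl H x)).
Qed.

Lemma coset_rep_in i : coset_rep i \in G.
Proof.
have /lcosetsP[x Gx def_i] := enum_valP i.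
have: coset_rep i \in (x *: H)%g by rewrite -def_i -lcoset_rep lcoset_refl.
case/lcosetP=> h Hh ->; exact: groupM Gx (subsetP sHG h Hh).
Qed.

Lemma coset_rep_exists a : a \in G -> exists i, (a * coset_rep i)%g \in H.
Proof.
move=> Ga; have cA: (a^-1 *: H)%g \in lcosets H G.
  by apply/lcosetsP; exists a^-1%g; rewrite ?groupV.
exists (enum_rank_in cA (a^-1 *: H)%g).
have := lcoset_rep (enum_rank_in cA (a^-1 *: H)%g).
rewrite enum_rankK_in //; move: (enum_rank_in _ _) => i def_i.
by rewrite -{1}[a]invgK -mem_lcoset -def_i lcoset_refl.
Qed.

Lemma coset_rep_uniq i j : ((coset_rep i)^-1 * coset_rep j)%g \in H -> i = j.
Proof.
rewrite -mem_lcoset => /lcoset_eqP eq_ij.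
by apply: enum_val_inj; rewrite -!lcoset_rep eq_ij.
Qed.

Lemma ext0_mxM a b : a \in H -> ext0_mx (a * b) = ext0_mx a *m ext0_mx b.
Proof.
move=> Ha; rewrite /ext0_mx groupMl // Ha; case: ifP => Hb; last by rewrite mulmx0.
by rewrite repr_mxM.
Qed.

Lemma sum_ext0_mx a b : a \in G ->
  \sum_i ext0_mx (a * coset_rep i) *m ext0_mx ((coset_rep i)^-1 * b)
    = ext0_mx (a * b).
Proof.
move=> Ga; have [i Hi] := coset_rep_exists Ga.
rewrite (bigD1 i) //= big1 ?addr0 => [|j ne_ji].
  by rewrite -ext0_mxM // !mulgA mulgK.
rewrite {1}/ext0_mx; case: ifP => [Hj|]; last by rewrite mul0mx.
case/eqP: ne_ji; apply/coset_rep_uniq.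
by rewrite -[(_^-1 * _)%g](mulKg (a * coset_rep j)%g) groupMl ?groupV //
           !mulgA mulgK.
Qed.

Lemma ind_mx_repr : mx_repr G ind_mx.
Proof.
split=> [|x y Gx Gy].
  rewrite /ind_mx -mxdiagZ /mxdiag; apply: eq_mxblock => i j.
  rewrite mulg1 /ext0_mx; have [<-|ne_ij] := eqVneq i j.
    by rewrite mulVg group1 repr_mx1 conform_mx_id.
  case: ifP => // /coset_rep_uniq eq_ij; by rewrite eq_ij eqxx in ne_ij.
rewrite /ind_mx mul_mxblock; apply: eq_mxblock => i j.
under eq_bigr => r _ do rewrite -(mulgA _ y).
by rewrite sum_ext0_mx ?groupM ?groupV ?coset_rep_in // !mulgA.
Qed.

Definition ind_repr : mx_representation k G (\sum_(i < #|lcosets H G|) l) :=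
  MxRepresentation ind_mx_repr.

(* The pure tensor g (x) v, for g in G. *)
Definition ind_tensor (g : gT) (v : 'rV[k]_l) :
    'rV[k]_(\sum_(i < #|lcosets H G|) l) :=
  \mxrow_(i < #|lcosets H G|) (v *m ext0_mx (g^-1 * coset_rep i)%g).

(* The form B_L^G: the blocks t_i (x) L are mutually orthogonal and each is a
   copy of (L, B_L); ind_formE is the usual formula on pure tensors. *)
Definition ind_form (BL : 'M[k]_l) : 'M[k]_(\sum_(i < #|lcosets H G|) l) :=
  \mxdiag_(i < #|lcosets H G|) BL.

Lemma ind_tensor_act x g v : x \in G -> g \in G ->
  lact ind_repr x (ind_tensor g v) = ind_tensor (x * g) v.
Proof.
move=> Gx Gg; rewrite /lact /= /ind_tensor /ind_mx mul_mxrow_mxblock.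
apply: eq_mxrow => j; rewrite invMg.
under eq_bigr => i _ do rewrite -mulmxA -(mulgA _ x^-1%g).
by rewrite -mulmx_sumr sum_ext0_mx ?groupV // !mulgA.
Qed.

Lemma ind_tensorMr g h v : h \in H ->
  ind_tensor (g * h) v = ind_tensor g (lact rH h v).
Proof.
move=> Hh; apply: eq_mxrow => j; rewrite /lact -mulmxA invMg -mulgA.
by rewrite ext0_mxM ?groupV // {1}/ext0_mx groupV Hh.
Qed.

Lemma ind_tensor_span (w : 'rV[k]_(\sum_(i < #|lcosets H G|) l)) :
  w = \sum_i ind_tensor (coset_rep i) (submxrow w i).
Proof.
rewrite -[LHS]submxrowK -mxrow_sum; apply: eq_mxrow => j.
rewrite (bigD1 j) //= big1 ?addr0 => [|i ne_ij].
  by rewrite /ext0_mx mulVg group1 repr_mx1 mulmx1.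
rewrite /ext0_mx; case: ifP => [/coset_rep_uniq eq_ij|]; last by rewrite mulmx0.
by rewrite eq_ij eqxx in ne_ij.
Qed.

Lemma ind_formE BL : is_Gform rH BL -> {in G &, forall g1 g2 v1 v2,
  bform (ind_form BL) (ind_tensor g1 v1) (ind_tensor g2 v2) =
    if (g1 *: H == g2 *: H)%g then bform BL (lact rH (g2^-1 * g1)%g v1) v2 else 0}.
Proof.
move=> [_ _ invB] g1 g2 Gg1 Gg2 v1 v2.
rewrite /bform /ind_form /ind_tensor mul_mxrow_mxdiag tr_mxrow mul_mxrow_mxcol.
have [i Hi] : exists i, (g2^-1 * coset_rep i)%g \in H.
  by apply: coset_rep_exists; rewrite groupV.
rewrite (bigD1 i) //= big1 ?addr0 => [|j ne_ji]; last first.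
  rewrite [X in _ *m (_ *m X)^T]/ext0_mx; case: ifP => [Hj|]; last first.
    by rewrite mulmx0 trmx0 mulmx0.
  case/eqP: ne_ji; apply/coset_rep_uniq.
  by rewrite -[(_^-1 * _)%g](mulKg (g2^-1 * coset_rep j)%g) groupMl ?groupV //
             !mulgA mulgK.
have eqH: (g1 *: H == g2 *: H)%g = ((g1^-1 * coset_rep i)%g \in H).
  have /lcoset_eqP->: g2 \in (coset_rep i *: H)%g.
    by rewrite mem_lcoset -groupV invMg invgK.
  by rewrite -mem_lcoset (sameP eqP lcoset_eqP) lcoset_sym.
rewrite eqH [X in v1 *m X]/ext0_mx; case: ifP => [Hi1|]; last first.
  by rewrite mulmx0 !mul0mx mxE.
set h := ((g2^-1 * coset_rep i)^-1)%g.
have Hh : h \in H by rewrite groupV.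
have hV : (h^-1 = g2^-1 * coset_rep i)%g by rewrite invgK.
rewrite -[RHS](invB h Hh) /bform /lact /ext0_mx Hi hV.
congr ((_ *m BL *m _) 0 0).
rewrite -mulmxA -repr_mxM; last 2 first.
- rewrite groupV; have ->: (g2^-1 * g1 =
    (g2^-1 * coset_rep i) * (g1^-1 * coset_rep i)^-1)%g.
    by rewrite invMg invgK !mulgA mulgK.
  by rewrite groupM ?groupV.
- by [].
by rewrite invMg invgK !mulgA mulgK.
Qed.

End Induction.

Section SymmetricVertices.

Variables (k : fieldType) (gT : finGroupType) (G : {group gT}).
Variables (n : nat) (rG : mx_representation k G n).

Definition projective_form (H : {group gT}) (sHG : H \subset G) (B : 'M[k]_n) :
    Prop :=
  exists l (rH : mx_representation k H l) (BL : 'M[k]_l),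
    is_Gform rH BL /\ component rG B (ind_repr sHG rH) (ind_form G H BL).

Definition symmetrically_projective (H : {group gT}) (sHG : H \subset G) :
    Prop :=
  exists2 B : 'M[k]_n, is_Gform rG B & projective_form sHG B.

Definition symmetric_vertex (T : {group gT}) : Prop :=
  (exists sTG : T \subset G, symmetrically_projective sTG)
  /\ (forall (S : {group gT}) (sSG : S \subset G),
        S \subset T -> symmetrically_projective sSG -> S = T).

End SymmetricVertices.

(* Main.v *)
Require Import Defs.
From HB Require Import structures.
From mathcomp Require Import all_boot all_order all_algebra all_fingroup.
From mathcomp Require Import mxrepresentation.

Set Implicit Arguments.
Unset Strict Implicit.
Unset Printing Implicit Defensive.

Import GRing.Theory.
Import GroupScope.
Local Open Scope ring_scope.

(** Write [Tr_H] for the sum over the cosets of [H] in [G] of the translates of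
an [H]-fixed vector.  Everything rests on a criterion in the style of Higman:
a form [B] on [M] is [H]-projective exactly when [B = Tr_H F] for a symmetric,
possibly degenerate, [H]-invariant form [F] ([component_trace],
[trace_component]).  An isometry into an induced module yields [F] by pulling
back the form on the inducing module; conversely any [F] is the restriction to
[M] of a nondegenerate form on [M + M*].  As [M] is irreducible over an
algebraically closed field, invariant endomorphisms are scalar and invariant
forms are proportional, so [M] is symmetrically [H]-projective exactly when
some such trace is nonzero ([symmetrically_projectiveP]).

Let [V] be of minimal order among the subgroups for which some [V]-fixed
endomorphism [a] has nonzero trace, normalised to [Tr_V a = 1]; it is a Green
vertex of [M].  A symmetric vertex [H] also has this property of [V], because
dividing a form by an invariant form turns it into an endomorphism, so
[|V| <= |H|].

If [|H| = |V|] the usual Mackey argument applies: for another symmetric vertex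
[K], the product of the traces from [H] and [K] is [1], and breaking it into
[G]-orbits produces a subgroup of [H] and of a conjugate of [K] from which a
trace is still nonzero; by minimality it is [H] ([projective_meet],
[min_order_vertex_conj]).

If [H] and [K] both have order greater than [|V|], products of translates as
above are useless, since they are not symmetric; the remedy is to sandwich.  Let
[B = Tr_H F] be the invariant form and expand
[(Tr_V a) * (Tr_H F) * (Tr_V a)^T = B] as the sum of all
[a_y * F_x * a_y'^T], with [y, y'] in [G/V] and [x] in [G/H].  Collect the
terms by the unordered pair [U = {y, y'}] and by [x]: each part is now a
symmetric form, fixed by the stabiliser of [(U, x)].  The sum over [x] alone is
[a_y * B * a_y'^T] summed over [{y, y'} = U], in which [H] has disappeared.
Hence an orbit of pairs [U0] with nonzero contribution can be chosen once and
for all, and for every symmetric vertex [H] some pair [(U, x)] with [U] in that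
orbit has a stabiliser from which a symmetric form has nonzero trace.  That
stabiliser lies in a conjugate of [H], so it is that conjugate, and it lies in
the stabiliser [Q] of [U], whose order is at most [2 |V|] since [U] has at most
two points ([sym_projective_pair]).  As [|H| > |V|], a conjugate of [H] is all
of [Q].  The same [Q] serves for [K], so [H] and [K] are conjugate. *)

(** * Relative traces and orbit sums *)

Lemma big_neq0 (I : finType) (V : zmodType) (Q : pred I) (F : I -> V) :
  \sum_(i | Q i) F i != 0 -> exists2 i, Q i & F i != 0.
Proof.
case: (boolP [exists i, Q i && (F i != 0)]) => [/existsP[i /andP[Qi nzi]] | ].
  by exists i.
rewrite negb_exists => /forallP noF /eqP[]; apply: big1 => i Qi.
by have := noF i; rewrite Qi negbK => /eqP.
Qed.

Section RelativeTrace.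

Variables (gT : finGroupType) (G : {group gT}) (V : zmodType).
Variable act : gT -> {additive V -> V}.

Definition linear_action : Prop :=
  (forall x, act 1%g x = x) /\
  {in G &, forall g h x, act (g * h)%g x = act h (act g x)}.

Hypothesis actP : linear_action.

Definition equivariant (Z : finType) (to : {action gT &-> Z}) (f : Z -> V) :=
  {in G, forall g z, f (to z g) = act g (f z)}.

(** On an [H]-fixed vector the chosen coset representatives do not matter: this
is the relative trace from [H] to [G]. *)
Definition rel_trace (H : {set gT}) (x : V) : V :=
  \sum_(C in rcosets H G) act (repr C) x.

(** The translates of [x] indexed by the cosets of [H], extended by [0] to all
subsets of the group so that the index set is a type on which [G] acts. *)
Definition coset_family (H : {set gT}) (x : V) (C : {set gT}) : V :=
  if C \in rcosets H G then act (repr C) x else 0.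

(** The predicate [P] is a constraint such as symmetry. For endomorphisms and
forms of an irreducible module a nonzero trace can be rescaled to any prescribed
invariant one, so relative projectivity comes down to nonvanishing. *)
Definition traceable (P : V -> Prop) (H : {group gT}) : Prop :=
  exists x, [/\ P x, {in H, forall h, act h x = x} & rel_trace H x != 0].

Lemma sum_coset_family H x : \sum_C coset_family H x C = rel_trace H x.
Proof. by rewrite /rel_trace [RHS]big_mkcond. Qed.

Section FixedVector.

Variables (H : {group gT}) (x : V).
Hypotheses (sHG : H \subset G) (fixHx : {in H, forall h, act h x = x}).

Lemma coset_familyE g : g \in G -> coset_family H x (H :* g) = act g x.
Proof.
move=> Gg; have [_ actM] := actP.
rewrite /coset_family mem_rcosets (subsetP (mulG_subr H G)) //.
case: repr_rcosetP => h Hh.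
by rewrite actM ?(subsetP sHG h Hh) // fixHx.
Qed.

Lemma coset_family_equivariant : equivariant 'Rs (coset_family H x).
Proof.
move=> g Gg C /=; have [_ actM] := actP.
have [/rcosetsP[a Ga ->] | notC] := boolP (C \in rcosets H G).
  rewrite (_ : rcoset _ _ = H :* (a * g)); last by rewrite rcosetE rcosetM.
  by rewrite !coset_familyE ?groupM // actM.
rewrite /coset_family (negPf notC) raddf0.
by rewrite -(acts_act (actsRs_rcosets H G) Gg) /= in notC; rewrite (negPf notC).
Qed.

Lemma rel_trace_fixed : {in G, forall g, act g (rel_trace H x) = rel_trace H x}.
Proof.
move=> g Gg /=; rewrite -sum_coset_family raddf_sum.
rewrite [RHS](reindex_inj (act_inj 'Rs%act g)) /=.
by apply: eq_bigr => C _; rewrite coset_family_equivariant.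
Qed.

End FixedVector.

Section Orbits.

Variables (Z : finType) (to : {action gT &-> Z}) (f : Z -> V).
Hypothesis f_equi : equivariant to f.

(** Cosets of the stabiliser of [z] parametrise the orbit of [z], so an orbit
sum of an equivariant family is a relative trace from a point stabiliser. This
is the only form in which double cosets enter. *)
Lemma sum_orbit z :
  \sum_(w in orbit to G z) f w = rel_trace 'C_G[z | to] (f z).
Proof.
rewrite orbit_stabilizer ?subsetT // big_imset /=; last first.
  exact: can_in_inj (act_reprK (subsetT G)).
apply: eq_bigr => _ /rcosetsP[a Ga ->]; apply: f_equi.
rewrite -[G :&: _]/(gval _); case: repr_rcosetP => b /setIP[Gb _].
exact: groupM.
Qed.

Lemma orbit_sum_neq0 (D : {set Z}) :
    [acts G, on D | to] -> \sum_(z in D) f z != 0 ->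
  exists z0, [/\ z0 \in D, f z0 != 0 & \sum_(w in orbit to G z0) f w != 0].
Proof.
move=> actsD; rewrite (set_partition_big _ (orbit_partition actsD)) /= => nz.
have [O /imsetP[z1 Dz1 defO] nzO] := big_neq0 nz.
have [z0 Oz0 nz0] := big_neq0 nzO.
rewrite {O}defO in nzO Oz0; exists z0; split=> //.
  exact: acts_in_orbit actsD Oz0 Dz1.
by rewrite (orbit_eqP Oz0).
Qed.

Lemma stabilizer_traceable (P : V -> Prop) z :
    P (f z) -> \sum_(w in orbit to G z) f w != 0 ->
  traceable P 'C_G[z | to].
Proof.
move=> Pz nz; exists (f z); split=> // [g|]; last by rewrite -sum_orbit.
by case/setIP=> Gg /astab1P zg; rewrite -f_equi // zg.
Qed.

End Orbits.

(** [H :^ g] is the stabiliser of the coset [H :* g], and the orbit sum of the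
translates of [x] is the same whichever coset is taken as the base point. *)
Lemma traceable_conj (P : V -> Prop) (H : {group gT}) g :
    {in G, forall h x, P x -> P (act h x)} -> H \subset G -> g \in G ->
  traceable P H -> traceable P (H :^ g)%G.
Proof.
move=> Pact sHG Gg [x [Px fixx nzx]].
have Hg : H :* g = 'Rs%act (gval H) g by rewrite /= rcosetE.
have -> : (H :^ g)%G = 'C_G[H :* g | 'Rs]%G.
  apply: val_inj => /=; rewrite Hg.
  rewrite astab1_act astab1Rs; apply/esym/setIidPr.
  by rewrite -(conjGid Gg) conjSg.
apply: (stabilizer_traceable (coset_family_equivariant sHG fixx)).
  by rewrite coset_familyE //; exact: Pact.
rewrite Hg (orbit_act _ _ Gg) orbitRs.
rewrite (eq_bigr (fun C => act (repr C) x)) // => C CG.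
by rewrite /coset_family CG.
Qed.

End RelativeTrace.

Section PairAction.

Variables (gT : finGroupType) (Y Z : finType).
Variables (to1 : {action gT &-> Y}) (to2 : {action gT &-> Z}).

Definition pair_act (z : Y * Z) (g : gT) := (to1 z.1 g, to2 z.2 g).

Lemma pair_act1 z : pair_act z 1 = z.
Proof. by case: z => y z; rewrite /pair_act !act1. Qed.

Lemma pair_actM z : act_morph pair_act z.
Proof. by move=> g h; rewrite /pair_act !actM. Qed.

Definition pair_action := TotalAction pair_act1 pair_actM.

Lemma astab1_pair z : 'C[z | pair_action] = 'C[z.1 | to1] :&: 'C[z.2 | to2].
Proof.
case: z => y z; apply/setP=> g; apply/idP/setIP => [/astab1P[] | []].
  by move=> y_g z_g; split; apply/astab1P.
move=> /astab1P/= y_g /astab1P/= z_g; apply/astab1P.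
by rewrite /= /pair_act y_g z_g.
Qed.

End PairAction.

Section CosetPairs.

Variables (gT : finGroupType) (G H : {group gT}) (V : zmodType).
Variable act : gT -> {additive V -> V}.
Variables (Y : finType) (to : {action gT &-> Y}).
Variable f : Y * {set gT} -> V.
Hypothesis f_equi : equivariant G act (pair_action to 'Rs) f.
Hypothesis f_supp : forall z, f z != 0 -> z.2 \in rcosets H G.

(** Mackey's argument: a nonzero total sum has a nonzero orbit sum, which is a
trace from the stabiliser of a point [(y, C)] of the orbit. Because [f] is
supported on cosets of [H], the point can be moved to one with [C = H], whose
stabiliser lies in [H]. *)
Lemma coset_pair_traceable (P : V -> Prop) (D : {set Y}) :
    (forall z, P (f z)) -> [acts G, on D | to] ->
    \sum_(y in D) \sum_C f (y, C) != 0 ->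
  exists2 y, y \in D &
    exists S : {group gT},
      [/\ traceable G act P S, S \subset H & S \subset 'C[y | to]].
Proof.
move=> Pf actsD; rewrite pair_big_dep /= => nz.
have actsDT : [acts G, on setX D [set: {set gT}] | pair_action to 'Rs].
  apply/actsP=> g Gg [y C]; rewrite !inE /= !andbT.
  exact: (acts_act actsD Gg).
have {}nz : \sum_(z in setX D [set: {set gT}]) f z != 0.
  congr (_ != 0): nz; apply: eq_big => [z | [y C] _ //].
  by rewrite !inE !andbT.
have [[y1 C1] [Dz1 nz1 nzO]] := orbit_sum_neq0 actsDT nz.
have /rcosetsP[a Ga /= defC] := f_supp nz1.
exists (to y1 a^-1%g).
  by rewrite (acts_act actsD) ?groupV //; move: Dz1; rewrite !inE andbT.
have Oz : (to y1 a^-1%g, gval H) \in orbit (pair_action to 'Rs) G (y1, C1).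
  apply/orbitP; exists a^-1%g; rewrite ?groupV //= /pair_act /= defC.
  by rewrite rcosetE rcosetK.
exists 'C_G[(to y1 a^-1%g, gval H) | pair_action to 'Rs]%G; split.
- by apply: (stabilizer_traceable f_equi) => //; rewrite (orbit_eqP Oz).
- by rewrite /= astab1_pair /= astab1Rs setIA subsetIr.
by rewrite /= astab1_pair /= setIA setIAC subsetIr.
Qed.

End CosetPairs.

(** * Endomorphisms and forms of a module *)

Section Forms.

Variables (k : fieldType) (gT : finGroupType) (G : {group gT}).

Lemma bformE n (B : 'M[k]_n) i j :
  bform B (delta_mx 0 i) (delta_mx 0 j) = B i j.
Proof. by rewrite /bform trmx_delta -mulmxA -colE -rowE !mxE. Qed.

Lemma bform_inj n (B C : 'M[k]_n) :
  (forall u v, bform B u v = bform C u v) -> B = C.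
Proof. by move=> eqBC; apply/matrixP=> i j; rewrite -!bformE. Qed.

Lemma bform_mul m n (A : 'M[k]_(m, n)) B u v :
  bform B (u *m A) (v *m A) = bform (A *m B *m A^T) u v.
Proof. by rewrite /bform trmx_mul !mulmxA. Qed.

Lemma bform_tr n (B : 'M[k]_n) u v : bform B^T u v = bform B v u.
Proof.
rewrite /bform -[in LHS](trmxK u) -!trmx_mul mulmxA.
by rewrite mxE.
Qed.

Lemma bform_nondegenerate n (B : 'M[k]_n) :
  (forall u, (forall v, bform B u v = 0) -> u = 0) <-> B \in unitmx.
Proof.
rewrite -row_free_unit -kermx_eq0; split=> [ndB | freeB u uB0].
  apply/eqP/row_matrixP=> i; rewrite row0; apply: ndB => v.
  by rewrite /bform -row_mul mulmx_ker row0 mul0mx mxE.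
have uB : u *m B = 0.
  apply/rowP=> j; have:= uB0 (delta_mx 0 j).
  by rewrite /bform trmx_delta -colE !mxE.
by have /sub_kermxP := uB; rewrite (eqP freeB) submx0 => /eqP.
Qed.

Section Actions.

Variables (n : nat) (rG : mx_representation k G n).

(** A right action of [G] on endomorphisms, whose fixed points are the module
endomorphisms. *)
Definition endo_act (g : gT) : {additive 'M[k]_n -> 'M[k]_n} :=
  mulmxr (rG g) \o mulmx (rG g^-1%g).

Definition form_act (g : gT) : {additive 'M[k]_n -> 'M[k]_n} :=
  mulmxr (rG g^-1%g)^T \o mulmx (rG g^-1%g).

Lemma endo_actP : linear_action G endo_act.
Proof.
split=> [x | g h Gg Gh x] /=; first by rewrite invg1 repr_mx1 mul1mx mulmx1.
by rewrite invMg !repr_mxM ?groupV // !mulmxA.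
Qed.

Lemma form_actP : linear_action G form_act.
Proof.
split=> [x | g h Gg Gh x] /=.
  by rewrite invg1 repr_mx1 mul1mx trmx1 mulmx1.
by rewrite invMg !repr_mxM ?groupV // trmx_mul !mulmxA.
Qed.

Lemma endo_actM g a b : g \in G ->
  endo_act g (a *m b) = endo_act g a *m endo_act g b.
Proof. by move=> Gg /=; rewrite !mulmxA repr_mxK. Qed.

(** A form can be multiplied by endomorphisms on both sides without leaving the
equivariant setting, which is what allows symmetric products such as [a F a^T]. *)
Lemma form_act_mul g a F b : g \in G ->
  form_act g (a *m F *m b^T) =
    endo_act g a *m form_act g F *m (endo_act g b)^T.
Proof.
move=> Gg /=; rewrite !trmx_mul !mulmxA repr_mxK //; do 2 congr (_ *m _).
rewrite -[RHS]mulmxA -trmx_mul -repr_mxM ?groupV //.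
by rewrite mulgV repr_mx1 trmx1 mulmx1.
Qed.

Lemma is_GformP B :
  is_Gform rG B <->
    [/\ B^T = B, B \in unitmx & {in G, forall g, form_act g B = B}].
Proof.
split=> [[symB /bform_nondegenerate uB invB] | [symB uB invB]].
  split=> // [|g Gg]; apply: bform_inj => u v; first by rewrite bform_tr symB.
  by rewrite -(invB g Gg) /lact bform_mul.
split=> [u v||g Gg u v]; first by rewrite -{1}symB bform_tr.
  exact/bform_nondegenerate.
by rewrite /lact bform_mul [X in bform X](invB g Gg).
Qed.

End Actions.

End Forms.

(** * Forms of relative trace type are the projective ones *)

Section Cotangent.

Variables (k : fieldType) (gT : finGroupType) (G : {group gT}).
Variables (n : nat) (rG : mx_representation k G n).

(** The module [M + M*], on which every symmetric form of [M] extends to a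
nondegenerate one. *)
Definition cotangent_mx (x : gT) : 'M[k]_(n + n) :=
  block_mx (rG x) 0 0 (dual_repr rG x).

Lemma cotangent_mx_repr : mx_repr G cotangent_mx.
Proof.
split=> [|x y Gx Gy]; rewrite /cotangent_mx.
  by rewrite !repr_mx1 -scalar_mx_block.
by rewrite mulmx_block !(mulmx0, mul0mx, addr0, add0r, repr_mxM).
Qed.

Definition cotangent_repr := MxRepresentation cotangent_mx_repr.

End Cotangent.

Section Projectivity.

Variables (k : fieldType) (gT : finGroupType) (G H : {group gT}).
Hypothesis sHG : H \subset G.
Variables (n : nat) (rG : mx_representation k G n).

Lemma ext0_out l (rH : mx_representation k H l) x :
  x \notin H -> ext0_mx rH x = 0.
Proof. by rewrite /ext0_mx => /negPf->. Qed.

(** Inversion carries the left cosets that index the blocks of an induced module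
to the right cosets that index a relative trace. *)
Lemma sum_coset_rep (F : 'M[k]_n) : {in H, forall h, form_act rG h F = F} ->
  \sum_(i < #|lcosets H G|) rG (coset_rep i) *m F *m (rG (coset_rep i))^T
    = rel_trace G (form_act rG) H F.
Proof.
move=> fixF; rewrite /rel_trace.
pose inv_set (C : {set gT}) := C^-1%g.
rewrite [RHS](reindex_onto inv_set inv_set); last by move=> C _; exact: invgK.
rewrite [RHS](eq_bigl (mem (lcosets H G))); last first.
  move=> C; rewrite /inv_set invgK eqxx andbT /=.
  by rewrite -[RHS]memV_invg invg_lcosets !invGid.
rewrite [RHS]big_enum_val /=; apply: eq_bigr => i _.
rewrite -lcoset_rep /inv_set invg_lcoset.
have Gt := coset_rep_in sHG i.
have := coset_familyE (form_actP rG) sHG fixF (groupVr Gt).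
rewrite /coset_family mem_rcosets (subsetP (mulG_subr H G)) ?groupV //=.
by rewrite invgK.
Qed.

(** Frobenius reciprocity: an isometry [A] into the induced module is determined
by its component [alpha] in the block of the trivial coset, and the blocks of
the induced form are orthogonal, so [B] is the trace of the pullback of [BL]
along [alpha]. *)
Lemma component_trace l (rH : mx_representation k H l) (BL : 'M[k]_l)
    (B : 'M[k]_n) :
    BL^T = BL -> {in H, forall h, form_act rH h BL = BL} ->
    component rG B (ind_repr sHG rH) (ind_form G H BL) ->
  exists F, [/\ F^T = F, {in H, forall h, form_act rG h F = F}
    & rel_trace G (form_act rG) H F = B].
Proof.
move=> symBL fixBL [A [homA isoA]].
(* Multiplication by tens b reads off the component at the coset of b. *)
pose tens b := \mxcol_(i < #|lcosets H G|) ext0_mx rH ((coset_rep i)^-1 * b)%g.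
pose alpha := A *m tens 1%g.
have homAE g : g \in G -> rG g *m A = A *m ind_repr sHG rH g.
  move=> Gg; apply/row_matrixP=> i; rewrite !row_mul !rowE.
  have := homA g^-1%g (groupVr Gg) (delta_mx 0 i).
  by rewrite /lact !invgK.
have tensM g b : g \in G -> ind_repr sHG rH g *m tens b = tens (g * b)%g.
  move=> Gg; rewrite /= /ind_mx /tens mul_mxblock_mxrow; apply: eq_mxcol => i.
  by rewrite sum_ext0_mx ?groupM ?groupV ?coset_rep_in // mulgA.
have alphaM g : g \in G -> rG g *m alpha = A *m tens g.
  by move=> Gg; rewrite mulmxA homAE // -mulmxA tensM // mulg1.
have alphaH h : h \in H -> rG h *m alpha = alpha *m rH h.
  move=> Hh; rewrite alphaM ?(subsetP sHG) // -mulmxA; congr (_ *m _).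
  rewrite /tens mxcol_mul; apply: eq_mxcol => i.
  rewrite mulg1 /ext0_mx groupMr //.
  by case: ifP => Hi; rewrite ?mul0mx // repr_mxM.
have defA : A = \mxrow_i (rG (coset_rep i) *m alpha).
  rewrite -[LHS]submxrowK; apply: eq_mxrow => i.
  rewrite alphaM ?coset_rep_in // -{2}[A]submxrowK /tens mul_mxrow_mxcol.
  rewrite (bigD1 i) //= big1 ?addr0 => [|j ne_ji].
    by rewrite /ext0_mx mulVg group1 repr_mx1 mulmx1.
  rewrite ext0_out ?mulmx0 //; apply: contra ne_ji => /coset_rep_uniq->.
  exact: eqxx.
clearbody alpha.
have fixF : {in H, forall h, form_act rG h (alpha *m BL *m alpha^T) =
                              alpha *m BL *m alpha^T}.
  move=> h Hh; rewrite -{2}(fixBL h Hh) /= !mulmxA alphaH ?groupV //.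
  by rewrite -!mulmxA -!trmx_mul alphaH ?groupV.
exists (alpha *m BL *m alpha^T); split=> //.
  by rewrite !trmx_mul trmxK symBL mulmxA.
rewrite -sum_coset_rep //.
have -> : B = A *m ind_form G H BL *m A^T.
  by apply: bform_inj => u v; rewrite -bform_mul isoA.
rewrite {1 2}defA /ind_form mul_mxrow_mxdiag tr_mxrow mul_mxrow_mxcol.
by apply: eq_bigr => i _; rewrite trmx_mul !mulmxA.
Qed.

(** The pulled back form [F] may be degenerate. It becomes the restriction of a
nondegenerate one on passing to [M + M*], with [M*] totally isotropic and paired
with [M] by evaluation. *)
Lemma trace_component F :
    F^T = F -> {in H, forall h, form_act rG h F = F} ->
  projective_form rG sHG (rel_trace G (form_act rG) H F).
Proof.
move=> symF fixF.
pose rL := subg_repr (cotangent_repr rG) sHG.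
pose BL : 'M[k]_(n + n) := block_mx F 1%:M 1%:M 0.
pose alpha : 'M[k]_(n, n + n) := row_mx 1%:M 0.
have alphaM h : rG h *m alpha = alpha *m rL h.
  by rewrite mul_mx_row mul_row_block !(mulmx0, mulmx1, mul1mx, mul0mx) !addr0.
have alphaB : alpha *m BL *m alpha^T = F.
  rewrite mul_row_block tr_row_mx mul_row_col.
  by rewrite !(trmx1, trmx0, mulmx0, mulmx1, mul1mx, mul0mx, addr0).
exists (n + n)%N, rL, BL; split.
  apply/is_GformP; split=> [||h Hh].
  - by rewrite tr_block_mx !trmx1 trmx0 symF.
  - suff /mulmx1_unit[] : BL *m block_mx 0 1%:M 1%:M (- F) = 1%:M by [].
    rewrite mulmx_block !(mulmx0, mulmx1, mul1mx, mul0mx) !addr0 add0r subrr.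
    by rewrite -scalar_mx_block.
  have Gh := subsetP sHG h Hh.
  rewrite /= /cotangent_mx /= /dual_mx tr_block_mx !mulmx_block.
  rewrite !(trmx0, mulmx0, mulmx1, mul0mx).
  rewrite !addr0 !add0r trmxK [X in block_mx X](fixF h Hh).
  by rewrite -trmx_mul -!repr_mxM ?groupV // mulgV repr_mx1 trmx1 mul0mx.
pose A := \mxrow_(i < #|lcosets H G|) (rG (coset_rep i) *m alpha).
have homA g : g \in G -> rG g *m A = A *m ind_repr sHG rL g.
  move=> Gg; rewrite /A /= /ind_mx mul_mxrow mul_mxrow_mxblock.
  apply: eq_mxrow => j.
  have Gtj := coset_rep_in sHG j.
  have [i Hi] := coset_rep_exists H (groupVr (groupM Gg Gtj)).
  have {}Hi : ((coset_rep i)^-1 * g * coset_rep j)%g \in H.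
    by rewrite -groupV invMg invgK mulgA in Hi.
  rewrite (bigD1 i) //= big1 ?addr0 => [|i' ne_i'i].
    rewrite /ext0_mx Hi -mulmxA -alphaM !mulmxA.
    rewrite -!repr_mxM ?groupM ?groupV ?coset_rep_in //.
    by rewrite !mulgA mulgV mul1g.
  rewrite ext0_out ?mulmx0 //; apply: contra ne_i'i => Hi'.
  apply/eqP/coset_rep_uniq.
  have -> : ((coset_rep i')^-1 * coset_rep i =
     ((coset_rep i')^-1 * g * coset_rep j)
     * ((coset_rep i)^-1 * g * coset_rep j)^-1)%g.
    by rewrite !invMg invgK !mulgA !mulgK.
  by rewrite groupM ?groupV.
exists A; split=> [g Gg v | u v].
  by rewrite /lact -!mulmxA homA ?groupV.
rewrite bform_mul -sum_coset_rep // /A /ind_form.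
rewrite mul_mxrow_mxdiag tr_mxrow mul_mxrow_mxcol.
congr bform; apply: eq_bigr => i _.
by rewrite trmx_mul -[in RHS]alphaB !mulmxA.
Qed.

End Projectivity.
(** * Forms attached to unordered pairs *)

Section UnorderedPairs.

Variables (k : fieldType) (n : nat) (Y : finType) (A : Y -> 'M[k]_n).

(** Grouping by the unordered pair makes the contribution symmetric; [U] may
also be a singleton, contributed by the diagonal. *)
Definition pair_form (F : 'M[k]_n) (U : {set Y}) : 'M[k]_n :=
  \sum_(p : Y * Y | [set p.1; p.2] == U) A p.1 *m F *m (A p.2)^T.

Lemma pair_form0 U : pair_form 0 U = 0.
Proof. by apply: big1 => p _; rewrite mulmx0 mul0mx. Qed.

Lemma pair_form_suml (I : finType) (F : I -> 'M[k]_n) U :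
  pair_form (\sum_i F i) U = \sum_i pair_form (F i) U.
Proof.
rewrite /pair_form exchange_big; apply: eq_bigr => p _ /=.
by rewrite mulmx_sumr mulmx_suml.
Qed.

Lemma sum_pair_form F :
  \sum_U pair_form F U = (\sum_y A y) *m F *m (\sum_y A y)^T.
Proof.
transitivity (\sum_(p : Y * Y) A p.1 *m F *m (A p.2)^T).
  by rewrite (partition_big (fun p => [set p.1; p.2]) predT).
rewrite raddf_sum /= !mulmx_suml.
under [RHS]eq_bigr do rewrite mulmx_sumr.
by rewrite pair_big.
Qed.

Lemma pair_form_sym F U : F^T = F -> (pair_form F U)^T = pair_form F U.
Proof.
move=> symF; rewrite /pair_form raddf_sum /=.
pose swap (p : Y * Y) := (p.2, p.1).
have swapK : involutive swap by case.
rewrite (reindex_inj (inv_inj swapK)) /=.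
apply: eq_big => [p | p _]; first by rewrite setUC.
by rewrite !trmx_mul trmxK symF mulmxA.
Qed.

Variables (gT : finGroupType) (G : {group gT}) (rG : mx_representation k G n).
Variable to : {action gT &-> Y}.
Hypothesis A_equi : equivariant G (endo_act rG) to A.

Lemma pair_form_act g F U : g \in G ->
  pair_form (form_act rG g F) (setact to U g) = form_act rG g (pair_form F U).
Proof.
move=> Gg; rewrite /pair_form raddf_sum.
rewrite (reindex_inj (act_inj (pair_action to to) g)).
apply: eq_big => [p | p _]; last by rewrite !A_equi // form_act_mul.
rewrite /=.
by rewrite -[RHS](inj_eq (imset_inj (act_inj to g))) imsetU1 imset_set1.
Qed.

End UnorderedPairs.

(** * Symmetric vertices of an irreducible module *)

Section IrreducibleModule.

Variables (k : closedFieldType) (gT : finGroupType) (G : {group gT}).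
Variables (n : nat) (rG : mx_representation k G n).
Hypothesis irrG : mx_irreducible rG.

Local Notation endoTr := (rel_trace G (endo_act rG)).
Local Notation formTr := (rel_trace G (form_act rG)).

Definition symmetric_mx (F : 'M[k]_n) : Prop := F^T = F.

Local Notation projective := (traceable G (endo_act rG) (fun=> True)).
Local Notation sym_projective := (traceable G (form_act rG) symmetric_mx).

Lemma irr_dim_gt0 : (0 < n)%N.
Proof. by have [] := (mx_irrP rG).1 irrG. Qed.

Lemma unitmx_neq0 (F : 'M[k]_n) : F \in unitmx -> F != 0.
Proof. by move=> uF; rewrite -mxrank_eq0 mxrank_unit // -lt0n irr_dim_gt0. Qed.

Lemma endo_fixed_scalar a :
  {in G, forall g, endo_act rG g a = a} -> exists c, a = c%:M.
Proof.
move=> fix_a; apply/is_scalar_mxP.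
apply: (mx_abs_irr_cent_scalar (group_closure_closed_field irrG)).
apply/centgmxP=> g Gg; rewrite -[in RHS](fix_a g Gg) /=.
by rewrite !mulmxA -repr_mxM ?groupV // mulgV repr_mx1 mul1mx.
Qed.

(** The radical of an invariant form is a submodule. *)
Lemma form_fixed_unit F :
  F != 0 -> {in G, forall g, form_act rG g F = F} -> F \in unitmx.
Proof.
move=> nzF fixF; rewrite -row_free_unit -kermx_eq0.
apply: contraR nzF => nz_ker.
have modK : mxmodule rG (kermx F).
  apply/mxmoduleP=> g Gg; apply/sub_kermxP.
  rewrite -[X in _ *m X](fixF g Gg) /= !mulmxA repr_mxK //.
  by rewrite mulmx_ker mul0mx.
have [_ irr] := (mx_irrP rG).1 irrG.
have /row_fullP[E EK] := irr _ modK nz_ker.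
by rewrite -[F]mul1mx -EK -mulmxA mulmx_ker mulmx0.
Qed.

Lemma endo_act_form F B g :
    B \in unitmx -> form_act rG g B = B -> g \in G ->
  endo_act rG g (F *m invmx B) = form_act rG g F *m invmx B.
Proof.
move=> uB fixB Gg.
have rB : rG g *m B = B *m (rG g^-1%g)^T.
  rewrite -[in LHS]fixB /= !mulmxA -repr_mxM ?groupV //.
  by rewrite mulgV repr_mx1 mul1mx.
have Br : invmx B *m rG g = (rG g^-1%g)^T *m invmx B.
  by apply: (can_inj (mulmxK uB)); rewrite mulmxKV // -mulmxA rB mulKmx.
by rewrite /= -!mulmxA Br.
Qed.

(** Two invariant forms differ by an invariant endomorphism, which is a scalar
by Schur's lemma. *)
Lemma form_fixed_scale F B :
    B != 0 -> {in G, forall g, form_act rG g B = B} ->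
    {in G, forall g, form_act rG g F = F} ->
  exists c, F = c *: B.
Proof.
move=> nzB fixB fixF; have uB := form_fixed_unit nzB fixB.
have [g Gg | c defc] := @endo_fixed_scalar (F *m invmx B).
  by rewrite endo_act_form ?fixB ?fixF.
by exists c; rewrite -mul_scalar_mx -defc mulmxKV.
Qed.

Lemma symmetrically_projectiveP (H : {group gT}) (sHG : H \subset G) :
  symmetrically_projective rG sHG <-> sym_projective H.
Proof.
split=> [[B /is_GformP[_ uB _] [l [rH [BL [GBL compB]]]]] |].
  have [symBL _ fixBL] := (is_GformP rH BL).1 GBL.
  have [F [symF fixF defB]] := component_trace symBL fixBL compB.
  by exists F; split=> //; rewrite defB unitmx_neq0.
case=> F [symF fixF nzF].
exists (formTr H F); last exact: trace_component.
have fixTr := rel_trace_fixed (form_actP rG) sHG fixF.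
apply/is_GformP; split=> //; last exact: form_fixed_unit.
rewrite /rel_trace raddf_sum; apply: eq_bigr => C _ /=.
by rewrite !trmx_mul trmxK symF mulmxA.
Qed.

Lemma symmetric_vertexP (T : {group gT}) :
  symmetric_vertex rG T ->
  [/\ T \subset G, sym_projective T &
      forall S : {group gT}, S \subset T -> sym_projective S -> S = T].
Proof.
case=> [[sTG /symmetrically_projectiveP symT] minT]; split=> // S sST symS.
have sSG := subset_trans sST sTG.
by apply: (minT S sSG sST); apply/symmetrically_projectiveP.
Qed.

Lemma projective_trace1 (H : {group gT}) :
    H \subset G -> projective H ->
  exists2 a, {in H, forall h, endo_act rG h a = a} & endoTr H a = 1%:M.
Proof.
move=> sHG [a [_ fix_a nz_a]].
have [c Tr_a] := endo_fixed_scalar (rel_trace_fixed (endo_actP rG) sHG fix_a).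
have nz_c : c != 0 by apply: contraNneq nz_a => c0; rewrite Tr_a c0 raddf0.
exists (c^-1 *: a) => [h Hh |].
  by rewrite -[in RHS](fix_a h Hh) /= -scalemxAr -scalemxAl.
rewrite -[1](mulVf nz_c) -scale_scalar_mx -Tr_a scaler_sumr.
by apply: eq_bigr => C _; rewrite /= -scalemxAr -scalemxAl.
Qed.

Lemma sym_projective_trace (H : {group gT}) B :
    B != 0 -> {in G, forall g, form_act rG g B = B} ->
    H \subset G -> sym_projective H ->
  exists F, [/\ F^T = F, {in H, forall h, form_act rG h F = F}
    & formTr H F = B].
Proof.
move=> nzB fixB sHG [F [symF fixF nzF]].
have fixTr := rel_trace_fixed (form_actP rG) sHG fixF.
have [c defB] := form_fixed_scale nzF fixTr fixB.
exists (c *: F); split=> [|h Hh|].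
- by rewrite linearZ /= symF.
- by rewrite -[in RHS](fixF h Hh) /= -scalemxAr -scalemxAl.
rewrite defB scaler_sumr.
by apply: eq_bigr => C _; rewrite /= -scalemxAr -scalemxAl.
Qed.

(** Dividing by the invariant form [Tr_H F] turns [F] into an endomorphism of
trace [1]. *)
Lemma sym_projective_projective (H : {group gT}) :
  H \subset G -> sym_projective H -> projective H.
Proof.
move=> sHG [F [symF fixF nzF]].
have fixB := rel_trace_fixed (form_actP rG) sHG fixF.
have uB := form_fixed_unit nzF fixB.
set B := rel_trace _ _ _ _ in nzF fixB uB *.
have actFB g : g \in G ->
    endo_act rG g (F *m invmx B) = form_act rG g F *m invmx B.
  by move=> Gg; rewrite endo_act_form ?fixB.
exists (F *m invmx B); split=> // [h Hh|].
  by rewrite actFB ?(subsetP sHG) // fixF.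
rewrite /rel_trace (eq_bigr (fun C => form_act rG (repr C) F *m invmx B)).
  rewrite -mulmx_suml [X in X *m _](erefl : _ = B) mulmxV //.
  exact: unitmx_neq0 (unitmx1 _ _).
move=> _ /rcosetsP[a Ga ->]; rewrite actFB //.
by case: repr_rcosetP => h Hh; rewrite groupM ?(subsetP sHG h Hh).
Qed.

(** The product of a trace from [H] and a trace from [K] is the sum of all
products of translates, to which Mackey's argument applies. Symmetry is lost in
the product, so only endomorphisms are obtained. *)
Lemma projective_meet (H K : {group gT}) :
    H \subset G -> K \subset G -> projective H -> projective K ->
  exists2 g, g \in G &
    exists S : {group gT}, [/\ projective S, S \subset H & S \subset K :^ g].
Proof.
move=> sHG sKG /(projective_trace1 sHG)[a fix_a Tr_a].
move=> /(projective_trace1 sKG)[b fix_b Tr_b].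
pose famH := coset_family G (endo_act rG) H a.
pose famK := coset_family G (endo_act rG) K b.
pose f (z : {set gT} * {set gT}) := famH z.2 *m famK z.1.
have f_equi : equivariant G (endo_act rG) (pair_action 'Rs 'Rs) f.
  move=> g Gg z; rewrite /f endo_actM //.
  congr (_ *m _); exact: (coset_family_equivariant (endo_actP rG)).
have f_supp z : f z != 0 -> z.2 \in rcosets H G.
  apply: contraR => notHz.
  by rewrite /f /famH /coset_family (negPf notHz) mul0mx.
have [|||C KC [S [projS sSH sSK]]] :=
    coset_pair_traceable f_equi f_supp (P := fun=> True) (D := rcosets K G).
- by [].
- exact: actsRs_rcosets.
- have -> : \sum_(C in rcosets K G) \sum_D f (C, D) = 1%:M.
    under eq_bigr do rewrite /f /= -mulmx_suml sum_coset_family Tr_a mul1mx.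
    rewrite -Tr_b; apply: eq_bigr => C KC.
    by rewrite /famK /coset_family KC.
  exact: unitmx_neq0 (unitmx1 _ _).
have /rcosetsP[g Gg defC] := KC.
exists g => //; exists S; split=> //; apply: subset_trans sSK _.
have -> : C = 'Rs%act (gval K) g by rewrite /= rcosetE.
by rewrite astab1_act astab1Rs.
Qed.

(** The key step. [Q] is the stabiliser of an unordered pair [U0] of cosets of
[V] whose orbit contributes to [(Tr_V a) B (Tr_V a)^T = B]. This contribution
does not involve [H]; writing [B] in it as a trace from [H] and applying
Mackey's argument to pairs formed of [U] in the orbit of [U0] and a coset of
[H] gives a subgroup of [H] that fixes some [U], and the corresponding terms
are symmetric. *)
Lemma sym_projective_pair (V : {group gT}) B :
    V \subset G -> projective V ->
    B != 0 -> {in G, forall g, form_act rG g B = B} ->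
  exists2 Q : {group gT}, (#|Q| <= 2 * #|V|)%N &
    forall H : {group gT}, H \subset G -> sym_projective H ->
  exists2 g, g \in G &
    exists S : {group gT},
      [/\ sym_projective S, S \subset H & S \subset Q :^ g].
Proof.
move=> sVG /(projective_trace1 sVG)[a fix_a Tr_a] nzB fixB.
pose A := coset_family G (endo_act rG) V a.
have A_equi : equivariant G (endo_act rG) 'Rs A.
  exact: (coset_family_equivariant (endo_actP rG) sVG fix_a).
have sumA : \sum_C A C = 1%:M by rewrite sum_coset_family.
have E_equi : equivariant G (form_act rG) ('Rs)^* (pair_form A B).
  by move=> g Gg U; rewrite -(pair_form_act A_equi) ?fixB.
have sumE : \sum_(U in [set: {set {set gT}}]) pair_form A B U != 0.
  rewrite (eq_bigl predT) => [|U]; last by rewrite inE.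
  by rewrite sum_pair_form sumA mul1mx trmx1 mulmx1.
have actsT : [acts G, on [set: {set {set gT}}] | ('Rs)^*].
  by apply/actsP=> g _ U; rewrite !inE.
have [U0 [_ nzU0 nzO]] := orbit_sum_neq0 actsT sumE.
exists 'C_G[U0 | ('Rs)^*]%G.
  (* The stabiliser of U0 permutes its at most two points, and the stabiliser of
     one of them is a conjugate of V. *)
  have [[C D] /= /eqP defU0] := big_neq0 nzU0.
  have [VC | notVC] := boolP (C \in rcosets V G); last first.
    by rewrite /A /coset_family (negPf notVC) !mul0mx eqxx.
  move=> _; have /rcosetsP[b Gb defC] := VC.
  rewrite -(card_orbit_stab 'Rs _ C) leq_mul //.
    have : (#|U0| <= 2)%N by rewrite -defU0 cards2; case: (_ != _).
    apply: leq_trans; apply: subset_leq_card.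
    apply/subsetP=> _ /orbitP[g /setIP[_ /astab1P Ug] <-].
    by rewrite -Ug /= mem_setact // -defU0 set21.
  rewrite -(cardJg V b); apply: subset_leq_card.
  apply: subset_trans (subsetIr _ _) _.
  have -> : C = 'Rs%act (gval V) b by rewrite /= rcosetE.
  by rewrite astab1_act astab1Rs.
move=> H sHG /(sym_projective_trace nzB fixB sHG)[F [symF fixF Tr_F]].
pose fam := coset_family G (form_act rG) H F.
pose f (z : {set {set gT}} * {set gT}) := pair_form A (fam z.2) z.1.
have f_equi : equivariant G (form_act rG) (pair_action ('Rs)^* 'Rs) f.
  move=> g Gg z; rewrite /f -(pair_form_act A_equi) //; congr (pair_form _ _ _).
  exact: (coset_family_equivariant (form_actP rG)).
have f_supp z : f z != 0 -> z.2 \in rcosets H G.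
  apply: contraR => notHz; rewrite /f /fam /coset_family (negPf notHz).
  by rewrite pair_form0.
have f_sym z : symmetric_mx (f z).
  apply: pair_form_sym; rewrite /fam /coset_family.
  case: ifP => _; last exact: trmx0.
  by rewrite /= !trmx_mul trmxK symF mulmxA.
have [||U OU [S [projS sSH sSU]]] :=
    coset_pair_traceable f_equi f_supp (D := orbit ('Rs)^* G U0) f_sym.
- by rewrite acts_orbit ?subsetT.
- under eq_bigr do rewrite /f /= -pair_form_suml sum_coset_family Tr_F.
  by [].
have /orbitP[g Gg defU] := OU.
exists g => //; exists S; split=> //.
have defSG : S :&: G = S by apply/setIidPl; exact: subset_trans sSH sHG.
by rewrite -defSG setIC /= conjIg conjGid // setIS // -astab1_act defU.
Qed.

(** Nonvanishing of a trace is not given as a decidable property, so a subgroup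
of minimal order is found only up to double negation; conjugacy being decidable,
this is enough. *)
Lemma exists_min_projective (W0 : {group gT}) :
    W0 \subset G -> projective W0 ->
  classically (exists V : {group gT}, [/\ V \subset G, projective V
    & forall W : {group gT}, W \subset G -> projective W -> (#|V| <= #|W|)%N]).
Proof.
have [m] := ubnP #|W0|; elim: m W0 => // m IHm W ltWm sWG projW.
pose smaller := exists W' : {group gT},
  [/\ W' \subset G, projective W' & (#|W'| < #|W|)%N].
move=> b minb.
apply: (@classic_EM smaller) => -[[W' [sW'G projW' ltW'W]] | minW].
  by apply: (IHm W') minb => //; apply: leq_trans ltW'W _.
apply: minb; exists W; split=> // W' sW'G projW'.
by rewrite leqNgt; apply/negP=> ltW'W; case: minW; exists W'.
Qed.

Lemma sym_projective_conj (H : {group gT}) g :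
  H \subset G -> g \in G -> sym_projective H -> sym_projective (H :^ g)%G.
Proof.
move=> sHG Gg; apply: (traceable_conj (form_actP rG)) => // h _ F symF.
by rewrite /symmetric_mx /= !trmx_mul trmxK symF mulmxA.
Qed.

(** The case of a symmetric vertex that is already a Green vertex. *)
Lemma min_order_vertex_conj (T K : {group gT}) :
    symmetric_vertex rG T -> symmetric_vertex rG K ->
    (forall W : {group gT}, W \subset G -> projective W -> (#|T| <= #|W|)%N) ->
  exists2 g, g \in G & K = (T :^ g)%G.
Proof.
move=> /symmetric_vertexP[sTG symT _] /symmetric_vertexP[sKG symK minK] minT.
have [g Gg [S [projS sST sSK]]] := projective_meet sTG sKG
  (sym_projective_projective sTG symT) (sym_projective_projective sKG symK).
have defS : S :=: T.
  by apply/eqP; rewrite eqEcard sST minT // (subset_trans sST).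
have sTK : (T :^ g^-1)%G \subset K by rewrite sub_conjgV -defS.
exists g^-1%g; rewrite ?groupV //; apply/esym/minK => //.
by apply: sym_projective_conj; rewrite ?groupV.
Qed.

Lemma subgroup_eq_card_lt2 (S R : {group gT}) :
  S \subset R -> (#|R| < 2 * #|S|)%N -> S :=: R.
Proof.
move=> sSR; rewrite -(Lagrange sSR) mulnC ltn_pmul2r ?cardG_gt0 // ltnS => le1.
have : #|R : S| == 1%N by rewrite eqn_leq le1 indexg_gt0.
by rewrite indexg_eq1 => sRS; apply/eqP; rewrite eqEsubset sSR.
Qed.

Lemma symmetric_vertex_conj (T1 T2 : {group gT}) :
    symmetric_vertex rG T1 -> symmetric_vertex rG T2 ->
  exists2 g, g \in G & T2 = (T1 :^ g)%G.
Proof.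
move=> vT1 vT2.
have [sT1G symT1 minT1] := symmetric_vertexP vT1.
have [sT2G symT2 minT2] := symmetric_vertexP vT2.
suff /exists_inP[g Gg /eqP defT2] : [exists g in G, T2 == (T1 :^ g)%G].
  by exists g.
apply: (exists_min_projective sT1G (sym_projective_projective sT1G symT1)).
case=> V [sVG projV minV]; apply/exists_inP.
have conj_of g : g \in G -> T2 = (T1 :^ g)%G ->
    exists2 h, h \in G & T2 == (T1 :^ h)%G.
  by move=> Gg ->; exists g.
have [leT1 | ltT1] := leqP #|T1| #|V|.
  have [|g Gg] := min_order_vertex_conj vT1 vT2; last exact: conj_of.
  by move=> W sWG /(minV W sWG); exact: leq_trans.
have [leT2 | ltT2] := leqP #|T2| #|V|.
  have [|g Gg defT1] := min_order_vertex_conj vT2 vT1.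
    by move=> W sWG /(minV W sWG); exact: leq_trans.
  apply: (conj_of g^-1%g); rewrite ?groupV //; apply: val_inj.
  by rewrite defT1 /= conjsgK.
have [F [symF fixF nzF]] := symT1.
have [Q leQ stabQ] := sym_projective_pair sVG projV nzF
  (rel_trace_fixed (form_actP rG) sT1G fixF).
have conjQ (T : {group gT}) : T \subset G -> sym_projective T ->
    (forall S : {group gT}, S \subset T -> sym_projective S -> S = T) ->
    (#|V| < #|T|)%N -> exists2 g, g \in G & T :=: Q :^ g.
  move=> sTG symT minT ltT; have [g Gg [S [symS sST sSQ]]] := stabQ T sTG symT.
  rewrite -(minT S sST symS); exists g => //.
  (* S = T has more than |V| elements, that is, more than half of those of Q. *)
  apply: subgroup_eq_card_lt2 sSQ _; rewrite cardJg (minT S sST symS).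
  by apply: leq_ltn_trans leQ _; rewrite ltn_pmul2l.
have [g1 Gg1 defT1] := conjQ T1 sT1G symT1 minT1 ltT1.
have [g2 Gg2 defT2] := conjQ T2 sT2G symT2 minT2 ltT2.
apply: (conj_of (g1^-1 * g2)%g); rewrite ?groupM ?groupV //; apply: val_inj.
by rewrite /= defT1 defT2 -conjsgM mulKVg.
Qed.

End IrreducibleModule.

Theorem theorem1p4 (k : closedFieldType) (chark2 : (2%N \in [pchar k])%R)
    (gT : finGroupType) (G : {group gT}) (evenG : ~~ odd #|G|)
    (n : nat) (rG : mx_representation k G n)
    (irrG : mx_irreducible rG) (dualG : self_dual rG)
    (T1 T2 : {group gT})
    (vertexT1 : symmetric_vertex rG T1) (vertexT2 : symmetric_vertex rG T2) :
  exists2 x : gT, x \in G & T2 = (T1 :^ x)%G.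
Proof. exact: symmetric_vertex_conj vertexT1 vertexT2. Qed.
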